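(* Let $\mathcal L_0\subset\mathbb R^d$ be an $(r,R)$-Delone set and $N\ge1$. The map $$\mathcal G_N\ni(\xi,\zeta)\mapsto\big(\xi,\,(\mathcal L_\xi,\chi_\zeta(1)),\,\hat{\mathfrak t}_{\chi_\zeta(1)}(\zeta)\big)\in\widetilde{\mathcal G}_N$$ is an isomorphism $\mathcal G_N\simeq\widetilde{\mathcal G}_N$ of topological groupoids, where $\widetilde{\mathcal G}_N$ is the blow-up of $\mathcal G_1$ through the map $\Xi^{(N)}_{\mathcal L_0}\to\Xi_{\mathcal L_0}$, $\xi\mapsto\mathcal L_\xi$.
   Context: Fix $d\ge1$, $0<r<R$. $\mathcal L\subset\mathbb R^d$ (discrete, infinite) is $(r,R)$-Delone if each closed ball of radius $r$ contains at most one point and each closed ball of radius $R$ at least one point of $\mathcal L$; $\mathrm{Del}$ is the set of these, with the topology of the metric $D(\Lambda,\Lambda')=\inf\{1/(1+\rho):d_H(\Lambda[\rho],\Lambda'[\rho])<1/\rho\}$ on closed subsets of $\mathbb R^d$, where $\Lambda[\rho]=(\Lambda\cap B(0,\rho))\cup\partial B(0,\rho)$ and $d_H$ is the Hausdorff distance. The hull $\Omega_{\mathcal L_0}$ is the closure of $\{\mathcal L_0-a:a\in\mathbb R^d\}$ and $\Xi_{\mathcal L_0}=\{\mathcal L\in\Omega_{\mathcal L_0}:0\in\mathcal L\}$. $\widehat{\mathrm{Del}}^{(N)}$ is the set of triples $\xi=(\mathcal L_\xi,V_\xi,\chi_\xi)$ with $\mathcal L_\xi\in\mathrm{Del}$,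 $V_\xi\subset\mathcal L_\xi$, $|V_\xi|=N$, $\chi_\xi:\{1,\dots,N\}\to V_\xi$ a bijection. A neighborhood base at $(\mathcal L,V,\chi)$: the sets of all $(\mathcal L',V',g\circ\chi)$ with $d_H(\mathcal L[M],\mathcal L'[M])<\epsilon$, $V'\subset\mathcal L'$, $|V'|=N$, $d_H(V,V')<\epsilon$, $g:V\to V'$ the unique bijection with $|g(v)-v|<\epsilon$ ($0<\epsilon<r/2$, $M$ large). $\mathfrak t_x(y)=y-x$, $\hat{\mathfrak t}_x\xi=(\mathcal L_\xi-x,V_\xi-x,\mathfrak t_x\circ\chi_\xi)$, acting diagonally on pairs. $\mathfrak a_N(\xi)=\mathcal L_\xi$. $\mathcal G_N=\{(\xi,\zeta)\in\widehat{\mathrm{Del}}^{(N)}\times\widehat{\mathrm{Del}}^{(N)}:\mathcal L_\xi=\mathcal L_\zeta\in\Omega_{\mathcal L_0},\ \chi_\xi(1)=0\}$ (relative topology) is an étale groupoid with $(\xi,\zeta)^{-1}=\hat{\mathfrak t}_{\chi_\zeta(1)}(\zeta,\xi)$ and $(\xi,\zeta)\cdot\hat{\mathfrak t}_{\chi_\zeta(1)}(\zeta,\zeta')=(\xi,\zeta')$; its unit space is $\Xi^{(N)}_{\mathcal L_0}=\{\xi\in\widehat{\mathrm{Del}}^{(N)}:\mathcal L_\xi\in\Xi_{\mathcal L_0},\ \chi_\xi(1)=0\}$. $\mathcal G_1=\{(\mathcal L,x)\in\Xi_{\mathcal L_0}\times\mathbb R^d:x\in\mathcal L\}$ with the relative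 topology, $(\mathcal L,x)^{-1}=(\mathcal L-x,-x)$ and $(\mathcal L,x)\cdot(\mathcal L-x,y)=(\mathcal L,x+y)$; unit space $\Xi_{\mathcal L_0}$, $\mathfrak r(\mathcal L,x)=\mathcal L$, $\mathfrak s(\mathcal L,x)=\mathcal L-x$. For a groupoid $\mathcal G$ and a continuous open map $f:Z\to\mathcal G^{(0)}$, the blow-up is $\mathcal G[Z]=\{(z,\gamma,w)\in Z\times\mathcal G\times Z:f(z)=\mathfrak r(\gamma),\ \mathfrak s(\gamma)=f(w)\}$ with $(z,\gamma,w)(w,\eta,x)=(z,\gamma\eta,x)$, $(z,\gamma,w)^{-1}=(w,\gamma^{-1},z)$ and the topology inherited from $Z\times\mathcal G\times Z$. Here $$\widetilde{\mathcal G}_N=\{(\xi,(\mathcal L,x),\zeta):(\mathcal L,x)\in\mathcal G_1,\ \xi\in\mathfrak a_N^{-1}(\mathcal L),\ \zeta\in\mathfrak a_N^{-1}(\mathcal L-x),\ \chi_\xi(1)=\chi_\zeta(1)=0\}.$$ *)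

(* Defs.v *)
From HB Require Import structures.
From mathcomp Require Import all_boot all_order all_algebra.
From mathcomp Require Import all_classical all_reals all_analysis.
From mathcomp Require Import ring lra.

Set Implicit Arguments.
Unset Strict Implicit.
Unset Printing Implicit Defensive.

Import Order.TTheory GRing.Theory Num.Theory.
Import numFieldNormedType.Exports.

Local Open Scope classical_set_scope.
Local Open Scope ring_scope.

Section Euclidean.
Context {R : realType} {d : nat}.
Notation E := 'rV[R]_d.

(* The norm `|x| that the library puts on 'rV[R]_d is the sup norm. It induces
   the topology of R^d, but balls and spheres below are Euclidean. *)
Definition enorm (x : E) : R := Num.sqrt (\sum_(i < d) x ord0 i ^+ 2).

Lemma enorm_ge0 x : 0 <= enorm x. Proof. exact: sqrtr_ge0. Qed.

Lemma sum_sq_ge0 (x : E) : 0 <= \sum_(i < d) x ord0 i ^+ 2.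
Proof. by apply: sumr_ge0 => i _; exact: sqr_ge0. Qed.

Lemma sqr_enorm x : enorm x ^+ 2 = \sum_(i < d) x ord0 i ^+ 2.
Proof. by rewrite sqr_sqrtr// sum_sq_ge0. Qed.

Lemma enorm0 : enorm 0 = 0.
Proof. by rewrite /enorm big1 ?sqrtr0// => i _; rewrite mxE expr0n. Qed.

Lemma enorm0_eq0 x : enorm x = 0 -> x = 0.
Proof.
move=> x0; apply/rowP => i; rewrite mxE.
have /eqP : \sum_(i < d) x ord0 i ^+ 2 = 0 by rewrite -sqr_enorm x0 expr0n.
rewrite psumr_eq0 => [/allP/(_ i)|j _]; last exact: sqr_ge0.
by rewrite mem_index_enum => /(_ isT) /=; rewrite sqrf_eq0 => /eqP.
Qed.

Lemma enormZ a x : enorm (a *: x) = `|a| * enorm x.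
Proof.
rewrite /enorm (eq_bigr (fun i => a ^+ 2 * x ord0 i ^+ 2)); last first.
  by move=> i _; rewrite mxE exprMn.
by rewrite -mulr_sumr sqrtrM ?sqr_ge0// sqrtr_sqr.
Qed.

Lemma enormN x : enorm (- x) = enorm x.
Proof. by rewrite -scaleN1r enormZ normrN1 mul1r. Qed.

Lemma enormB x y : enorm (x - y) = enorm (y - x).
Proof. by rewrite -enormN opprB. Qed.

Lemma dot_le_enorm (x y : E) :
  \sum_(i < d) x ord0 i * y ord0 i <= enorm x * enorm y.
Proof.
set a := enorm x; set b := enorm y.
have [a0|a0] := eqVneq a 0.
  rewrite a0 mul0r big1// => i _.
  by rewrite (enorm0_eq0 a0) mxE mul0r.
have [b0|b0] := eqVneq b 0.
  rewrite b0 mulr0 big1// => i _.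
  by rewrite (enorm0_eq0 b0) mxE mulr0.
have agt : 0 < a by rewrite lt_neqAle eq_sym a0 enorm_ge0.
have bgt : 0 < b by rewrite lt_neqAle eq_sym b0 enorm_ge0.
have : 0 <= \sum_(i < d) (b * x ord0 i - a * y ord0 i) ^+ 2.
  by apply: sumr_ge0 => i _; exact: sqr_ge0.
rewrite (eq_bigr (fun i => b ^+ 2 * x ord0 i ^+ 2 + a ^+ 2 * y ord0 i ^+ 2
   - (2 * (a * b)) * (x ord0 i * y ord0 i))); last by move=> i _; ring.
rewrite sumrB big_split/= -!mulr_sumr -!sqr_enorm -/a -/b => h.
have ab : 0 < 2 * (a * b) by rewrite !mulr_gt0.
rewrite -(ler_pM2l ab); apply: (le_trans (y := b ^+ 2 * a ^+ 2 + a ^+ 2 * b ^+ 2)).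
  by rewrite -subr_ge0.
by rewrite le_eqVlt; apply/orP; left; apply/eqP; ring.
Qed.

Lemma ler_enormD x y : enorm (x + y) <= enorm x + enorm y.
Proof.
rewrite -(@ler_pXn2r _ 2)// ?nnegrE ?addr_ge0 ?enorm_ge0//.
rewrite sqr_enorm (eq_bigr (fun i => x ord0 i ^+ 2 + y ord0 i ^+ 2
   + 2 * (x ord0 i * y ord0 i))); last by move=> i _; rewrite mxE; ring.
rewrite !big_split/= -mulr_sumr -!sqr_enorm sqrrD.
have := dot_le_enorm x y; lra.
Qed.

Lemma enorm_triangle y x z : enorm (x - z) <= enorm (x - y) + enorm (y - z).
Proof.
have -> : x - z = (x - y) + (y - z) by rewrite addrA subrK.
exact: ler_enormD.
Qed.

Lemma enorm_sphere (y : E) (rho : R) : 0 <= rho -> enorm y != 0 ->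
  enorm ((rho / enorm y) *: y) = rho.
Proof.
by move=> rho0 y0; rewrite enormZ ger0_norm ?divr_ge0 ?enorm_ge0// divfK.
Qed.

(* A point of the closed ball of radius [rho] is at least as close to the
   sphere of radius [rho] as to any point outside the ball. *)
Lemma sphere_between (x y : E) rho : enorm x <= rho -> rho < enorm y ->
  exists2 s, enorm s = rho & enorm (x - s) <= enorm (x - y).
Proof.
move=> xr ry; have rho0 : 0 <= rho := le_trans (enorm_ge0 x) xr.
have [x0|x0] := eqVneq (enorm x) 0.
  have y0 : enorm y != 0 by rewrite gt_eqF// (le_lt_trans rho0).
  exists ((rho / enorm y) *: y); first exact: enorm_sphere.
  by rewrite (enorm0_eq0 x0) !sub0r !enormN enorm_sphere// ltW.
exists ((rho / enorm x) *: x); first exact: enorm_sphere.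
have xgt : 0 < enorm x by rewrite lt_neqAle eq_sym x0 enorm_ge0.
have -> : x - (rho / enorm x) *: x = - ((rho / enorm x - 1) *: x).
  by rewrite scalerBl scale1r opprB.
rewrite enormN enormZ ger0_norm; last first.
  by rewrite subr_ge0 ler_pdivlMr// mul1r.
rewrite mulrBl mul1r divfK// enormB.
have := ler_enormD (y - x) x; rewrite subrK; lra.
Qed.

Definition close_within (e : R) (A B : set E) : Prop :=
  (forall a, A a -> exists2 b, B b & enorm (a - b) <= e) /\
  (forall b, B b -> exists2 a, A a & enorm (b - a) <= e).

Definition hausdorff_dist (A B : set E) : \bar R :=
  ereal_inf [set e%:E | e in [set e : R | 0 <= e /\ close_within e A B]].

(* Lambda[rho]; the union with the sphere makes it irrelevant whether the ball
   is open or closed. *)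
Definition truncation (A : set E) (rho : R) : set E :=
  (A `&` [set x | enorm x <= rho]) `|` [set x | enorm x = rho].

Definition tiling_dist (A B : set E) : R :=
  inf [set (1 + rho)^-1 | rho in [set rho : R | 0 < rho /\
    (hausdorff_dist (truncation A rho) (truncation B rho) < (rho^-1)%:E)%E]].

Lemma close_withinC e A B : close_within e A B -> close_within e B A.
Proof. by case. Qed.

Lemma close_withinxx e A : 0 <= e -> close_within e A A.
Proof. by move=> e0; split => a Aa; exists a => //; rewrite subrr enorm0. Qed.

Lemma close_within_trans e1 e2 A B C :
  close_within e1 A B -> close_within e2 B C -> close_within (e1 + e2) A C.
Proof.
move=> [AB BA] [BC CB]; split.
- move=> a /AB[b /BC[c Cc bc] ab]; exists c => //.
  by rewrite (le_trans (enorm_triangle b _ _))// lerD.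
- move=> c /CB[b /BA[a Aa ba] cb]; exists a => //.
  by rewrite (le_trans (enorm_triangle b _ _))// addrC lerD.
Qed.

Lemma hausdorff_dist_ltP A B (e : R) : (hausdorff_dist A B < e%:E)%E <->
  exists e' : R, [/\ 0 <= e', e' < e & close_within e' A B].
Proof.
split=> [/ereal_inf_lt[_ [e' [e'0 ABe']] <-]|[e' [e'0 e'e ABe']]].
  by rewrite lte_fin => e'e; exists e'.
apply: (@le_lt_trans _ _ e'%:E); last by rewrite lte_fin.
by apply: ereal_inf_lbound; exists e'.
Qed.

Lemma truncation_close_half e A B (tau rho : R) : tau <= rho -> 0 <= e ->
  (forall a, truncation A rho a ->
     exists2 b, truncation B rho b & enorm (a - b) <= e) ->
  forall a, truncation A tau a ->
     exists2 b, truncation B tau b & enorm (a - b) <= e.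
Proof.
move=> taurho e0 AB a [[Aa atau]|atau]; last first.
  by exists a; [right|rewrite subrr enorm0].
have [|b Bb ab] := AB a; first by left; split => //=; exact: le_trans atau taurho.
have [btau|btau] := leP (enorm b) tau; last first.
  have [s stau sab] := sphere_between atau btau.
  by exists s; [right|exact: le_trans ab].
exists b => //; case: Bb => [[Bb _]|/= brho]; first by left.
by right => /=; apply/eqP; rewrite eq_le btau brho.
Qed.

Lemma truncation_close e A B (tau rho : R) : tau <= rho -> 0 <= e ->
  close_within e (truncation A rho) (truncation B rho) ->
  close_within e (truncation A tau) (truncation B tau).
Proof.
by move=> tr e0 [AB BA]; split; [move: AB|move: BA];
  exact: truncation_close_half.
Qed.

End Euclidean.

Section Delone.
Context {R : realType} {d : nat}.
Notation E := 'rV[R]_d.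

Definition is_delone (r Rc : R) (L : set E) : Prop :=
  [/\ L `<=` isolated L,
      infinite_set L,
      (forall c x y, L x -> L y ->
         enorm (x - c) <= r -> enorm (y - c) <= r -> x = y) &
      (forall c, exists2 x, L x & enorm (x - c) <= Rc)].

Definition shift_set (a : E) (A : set E) : set E := [set y - a | y in A].

Lemma shift_inj (a : E) : injective (fun y : E => y - a).
Proof. by move=> x y /addIr. Qed.

Lemma shift_setP (a : E) (A : set E) y : shift_set a A y <-> A (y + a).
Proof.
split=> [[z Az <-]|Aya]; first by rewrite subrK.
by exists (y + a) => //; rewrite addrK.
Qed.

Lemma is_delone_shift r Rc (L : set E) a :
  is_delone r Rc L -> is_delone r Rc (shift_set a L).
Proof.
move=> [disc inf sep dense]; split.
- move=> y /shift_setP Ly; have [_ [V Vy VL]] := disc _ Ly.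
  split; first by rewrite inE; apply/shift_setP.
  exists [set z | V (z + a)].
    have : (fun z : E => z + a) @ y --> y + a.
      exact: (cvgD cvg_id (cvg_cst _)).
    exact.
  apply/seteqP; split => z /=.
    move=> [Vz /shift_setP Lz].
    have : [set y + a] (z + a) by rewrite -VL.
    by move=> /= /addIr.
  move=> ->; have : (V `&` L) (y + a) by rewrite VL.
  by move=> [? ?]; split => //; apply/shift_setP.
- move=> fin; apply: inf.
  have -> : L = shift_set (- a) (shift_set a L).
    by apply/seteqP; split => x; rewrite !shift_setP subrK.
  exact: finite_image.
- move=> c x y /shift_setP Lx /shift_setP Ly xc yc.
  apply: (@addIr _ a); apply: (sep (c + a)) => //.
    by rewrite opprD addrACA subrr addr0.
  by rewrite opprD addrACA subrr addr0.
- move=> c; have [x Lx xc] := dense (c + a).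
  exists (x - a); first by apply/shift_setP; rewrite subrK.
  by rewrite -addrA -opprD (addrC a).
Qed.

End Delone.

Record delone (R : realType) (d : nat) (r Rc : {posnum R}) : Type := Delone {
  delone_set :> set 'rV[R]_d;
  deloneP : is_delone r%:num Rc%:num delone_set }.

Section DelMetric.
Context {R : realType} {d : nat} {r Rc : {posnum R}}.
Notation E := 'rV[R]_d.
Notation Del := (delone d r Rc).

HB.instance Definition _ := gen_eqMixin Del.
HB.instance Definition _ := gen_choiceMixin Del.

Lemma delone_eq (L L' : Del) : (L = L' :> set E) -> L = L'.
Proof.
case: L L' => [L HL] [L' HL'] /= LL'; subst L'.
by congr Delone; exact: Prop_irrelevance.
Qed.

Definition del_dist (L L' : Del) : R := tiling_dist L L'.

Lemma delone_neq0 (L : Del) : exists2 x, delone_set L x & enorm x != 0.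
Proof.
have [_ inf _ _] := deloneP L; apply: contrapT => H; apply: inf.
apply: (@sub_finite_set _ _ [set 0]); last exact: finite_set1.
move=> x Lx; apply: enorm0_eq0; apply: contrapT => /eqP x0.
by apply: H; exists x.
Qed.

Lemma truncation_close_small (L L' : Del) rho : 0 <= rho ->
  close_within (2 * rho) (truncation L rho) (truncation L' rho).
Proof.
move=> rho0; have [x _ x0] := delone_neq0 L.
pose s := (rho / enorm x) *: x.
have sr : enorm s = rho by rewrite enorm_sphere.
suff trle A (y : E) : truncation A rho y -> enorm y <= rho.
  split=> a /trle arho; exists s; try (by right); rewrite mulr2n mulrDl mul1r.
    by rewrite (le_trans (ler_enormD _ _))// enormN sr lerD.
  by rewrite (le_trans (ler_enormD _ _))// enormN sr lerD.
by move=> [[]//|/= ->].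
Qed.

Lemma del_dist_lb (L L' : Del) : has_inf
  [set (1 + rho)^-1 | rho in [set rho : R | 0 < rho /\
    (hausdorff_dist (truncation L rho) (truncation L' rho) < (rho^-1)%:E)%E]].
Proof.
split; last first.
  by exists 0 => _ [rho [rho0 _] <-]; rewrite invr_ge0 addr_ge0// ltW.
exists (1 + 2^-1)^-1, 2^-1 => //; split; first by rewrite invr_gt0.
apply/hausdorff_dist_ltP; exists (2 * 2^-1); split.
- by rewrite divff.
- by rewrite divff// invrK ltr1n.
- by apply: truncation_close_small; rewrite invr_ge0.
Qed.

Lemma del_dist_ltP (L L' : Del) e : del_dist L L' < e <->
  exists rho, [/\ 0 < rho, (1 + rho)^-1 < e &
    exists e' : R, [/\ 0 <= e', e' < rho^-1 &
      close_within e' (truncation L rho) (truncation L' rho)]].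
Proof.
have [ne lb] := del_dist_lb L L'; split.
  move=> /(inf_lt ne)[_ [rho [rho0 /hausdorff_dist_ltP ?] <-] ?].
  by exists rho.
move=> [rho [rho0 rhoe H]]; apply: le_lt_trans rhoe.
apply: (ge_inf lb); exists rho => //; split=> //.
exact/hausdorff_dist_ltP.
Qed.

Lemma del_dist_ge0 (L L' : Del) : 0 <= del_dist L L'.
Proof.
rewrite leNgt; apply/negP => /del_dist_ltP[rho [rho0]].
by rewrite ltNge invr_ge0 addr_ge0// ltW.
Qed.

Lemma del_dist_lt1 (L L' : Del) : del_dist L L' < 1.
Proof.
have [[_ [rho [rho0 +] _]] _] := del_dist_lb L L'.
move=> /hausdorff_dist_ltP ?; apply/del_dist_ltP; exists rho; split => //.
by rewrite invf_lt1 ?ltrDl// addr_gt0.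
Qed.

Lemma del_distxx (L : Del) : del_dist L L = 0.
Proof.
apply/eqP; rewrite eq_le del_dist_ge0 andbT leNgt; apply/negP => D0.
set D := del_dist L L in D0; suff : D < D by rewrite ltxx.
have Di : D < D^-1.
  have := del_dist_lt1 L L; rewrite -/D => D1.
  by rewrite (lt_trans D1)// invf_gt1.
apply/del_dist_ltP; exists D^-1; split; first by rewrite invr_gt0.
  rewrite invf_plt ?posrE ?addr_gt0 ?invr_gt0//.
  by rewrite ltrDr.
by exists 0; rewrite invrK; split => //; exact: close_withinxx.
Qed.

Lemma del_dist_sym (L L' : Del) : del_dist L L' = del_dist L' L.
Proof.
suff H (A B : Del) : del_dist A B <= del_dist B A by apply/eqP; rewrite eq_le !H.
rewrite leNgt; apply/negP => /del_dist_ltP[rho [rho0 rhoe [e' [e0 e1 C]]]].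
suff : del_dist A B < del_dist A B by rewrite ltxx.
by apply/del_dist_ltP; exists rho; split => //; exists e'; split => //;
  exact: close_withinC.
Qed.

Lemma del_dist_triangle (L' L L'' : Del) :
  del_dist L L'' <= del_dist L L' + del_dist L' L''.
Proof.
rewrite leNgt; apply/negP => H.
pose h := (del_dist L L'' - (del_dist L L' + del_dist L' L'')) / 2.
have h0 : 0 < h by rewrite divr_gt0// subr_gt0.
have [|rho [rho0 rhoe [e1 [e10 e1r C1]]]] :=
  (del_dist_ltP L L' (del_dist L L' + h)).1; first by rewrite ltrDl.
have [|sig [sig0 sige [e2 [e20 e2r C2]]]] :=
  (del_dist_ltP L' L'' (del_dist L' L'' + h)).1; first by rewrite ltrDl.
set a := (1 + rho)^-1 in rhoe; set b := (1 + sig)^-1 in sige.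
have abD : a + b < del_dist L L'' by rewrite /h in rhoe sige; lra.
have ab1 : a + b < 1 := lt_trans abD (del_dist_lt1 _ _).
have a0 : 0 < a by rewrite invr_gt0 addr_gt0.
have b0 : 0 < b by rewrite invr_gt0 addr_gt0.
have rhoE : rho = (1 - a) / a.
  by rewrite mulrBl divff ?gt_eqF// mul1r /a invrK addrC addKr.
have sigE : sig = (1 - b) / b.
  by rewrite mulrBl divff ?gt_eqF// mul1r /b invrK addrC addKr.
pose tau := (1 - (a + b)) / (a + b).
have tau0 : 0 < tau by rewrite divr_gt0 ?subr_gt0 ?addr_gt0.
have tauD : (1 + tau)^-1 = a + b.
  by rewrite /tau mulrBl divff ?gt_eqF ?addr_gt0// mul1r addrC subrK invrK.
suff : del_dist L L'' < del_dist L L'' by rewrite ltxx.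
apply/del_dist_ltP; exists tau; split => //; first by rewrite tauD.
exists (e1 + e2); split; first exact: addr_ge0.
  have tauV : tau^-1 = a / (1 - (a + b)) + b / (1 - (a + b)).
    by rewrite /tau invf_div mulrDl.
  rewrite tauV; apply: ltrD.
    rewrite (lt_le_trans e1r)// rhoE invf_div ler_wpM2l ?ltW//.
    by rewrite ltf_pV2 ?posrE ?subr_gt0//; lra.
  rewrite (lt_le_trans e2r)// sigE invf_div ler_wpM2l ?ltW//.
  by rewrite ltf_pV2 ?posrE ?subr_gt0//; lra.
have Vle (x : R) : 0 < x -> x <= a + b -> (1 - (a + b)) / (a + b) <= (1 - x) / x.
  move=> x0 xab; rewrite !mulrBl !divff ?gt_eqF ?addr_gt0// lerD2r !mul1r.
  by rewrite lef_pV2 ?posrE ?addr_gt0.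
apply: close_within_trans.
  by apply: (truncation_close _ e10 C1); rewrite rhoE; apply: Vle => //; lra.
by apply: (truncation_close _ e20 C2); rewrite sigE; apply: Vle => //; lra.
Qed.

Lemma del_dist0_sub (L L' : Del) : del_dist L L' = 0 -> L `<=` L'.
Proof.
move=> D0 x Lx.
have app (e : R) : 0 < e -> exists2 y, delone_set L' y & enorm (x - y) < e.
  move=> e0; pose M := enorm x + 1 + e^-1.
  have M0 : 0 < M by rewrite addr_gt0 ?invr_gt0// ltr_wpDl ?enorm_ge0.
  have [|rho [rho0 rhoe [e' [e'0 e'r [C _]]]]] :=
    (del_dist_ltP L L' (1 + M)^-1).1; first by rewrite D0 invr_gt0 addr_gt0.
  have Mrho : M < rho.
    have rho1 : 0 < 1 + rho by rewrite addr_gt0.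
    have M1 : 0 < 1 + M by rewrite addr_gt0.
    by move: rhoe; rewrite (ltf_pV2 rho1 M1) ltrD2l.
  have rhoV1 : rho^-1 < 1.
    rewrite invf_lt1// (le_lt_trans _ Mrho)// /M.
    have := enorm_ge0 x; have : 0 < e^-1 by rewrite invr_gt0.
    lra.
  have rhoVe : rho^-1 < e.
    rewrite invf_plt ?posrE// (le_lt_trans _ Mrho)// /M.
    have := enorm_ge0 x; lra.
  have [|y [[L'y _]|/= yrho] xy] := C x.
  - left; split => //=; rewrite ltW// (le_lt_trans _ Mrho)// /M.
    by rewrite -addrA lerDl addr_ge0// invr_ge0 ltW.
  - by exists y => //; lra.
  - have := ler_enormD (y - x) x; rewrite subrK yrho enormB.
    have : 0 < e^-1 by rewrite invr_gt0.
    by rewrite /M in Mrho; lra.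
have [_ _ sep _] := deloneP L'.
have [y L'y xy] := app _ (gt0 r).
suff -> : x = y by [].
apply/eqP; rewrite -subr_eq0; apply/eqP; apply: enorm0_eq0.
apply/eqP; rewrite eq_le enorm_ge0 andbT leNgt; apply/negP => xy0.
have [|z L'z] := app (Num.min r%:num (enorm (x - y))).
  by rewrite lt_min xy0 gt0.
rewrite lt_min => /andP[xz xzy].
suff zy : z = y by rewrite zy ltxx in xzy.
by apply: (sep x) => //; rewrite enormB ltW.
Qed.

Lemma del_dist_positivity (L L' : Del) : del_dist L L' = 0 -> L = L'.
Proof.
move=> D0; apply: delone_eq; apply/seteqP; split; apply: del_dist0_sub => //.
by rewrite del_dist_sym.
Qed.

HB.instance Definition _ := isMetric.Build R Del
  del_distxx del_dist_positivity del_dist_sym del_dist_triangle.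

Definition del_shift (a : E) (L : Del) : Del :=
  Delone (is_delone_shift a (deloneP L)).

Definition hull (L0 : Del) : set Del :=
  closure [set del_shift a L0 | a in [set: E]].

Definition hull_transversal (L0 : Del) : set Del :=
  [set L | hull L0 L /\ delone_set L 0].

End DelMetric.

Record pattern (R : realType) (d : nat) (r Rc : {posnum R}) (N : nat) : Type :=
  Pattern {
    lattice : delone d r Rc;
    marks : set 'rV[R]_d;
    label : 'I_N -> 'rV[R]_d;
    marks_sub : marks `<=` lattice;
    label_bij : set_bij [set: 'I_N] marks label }.

Section Patterns.
Context {R : realType} {d : nat} {r Rc : {posnum R}} {N : nat}.
Notation E := 'rV[R]_d.
Notation Pat := (pattern d r Rc N).

HB.instance Definition _ := gen_eqMixin Pat.
HB.instance Definition _ := gen_choiceMixin Pat.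

Definition pattern_base (xi : Pat) (M e : R) : set Pat :=
  [set zeta : Pat |
    [/\ (hausdorff_dist (truncation (lattice xi) M)
           (truncation (lattice zeta) M) < e%:E)%E,
        (hausdorff_dist (marks xi) (marks zeta) < e%:E)%E &
        exists g : E -> E,
          [/\ set_bij (marks xi) (marks zeta) g,
              forall v, marks xi v -> enorm (g v - v) < e &
              label zeta = g \o label xi]]].

Definition pattern_nbhs (xi : Pat) : set_system Pat :=
  filter_from [set p : R * R | 0 < p.1 /\ 0 < p.2 < r%:num / 2]
    (fun p => pattern_base xi p.1 p.2).

HB.instance Definition _ := hasNbhs.Build Pat pattern_nbhs.

Lemma pattern_base_refl xi M e : 0 < e -> pattern_base xi M e xi.
Proof.
move=> e0; split.
- by apply/hausdorff_dist_ltP; exists 0; split => //; exact: close_withinxx.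
- by apply/hausdorff_dist_ltP; exists 0; split => //; exact: close_withinxx.
- exists id; split; last by [].
    by split; [|move=> x y _ _|move=> x ?; exists x].
  by move=> v _; rewrite subrr enorm0.
Qed.

Lemma pattern_base_mono xi M M' e e' : M' <= M -> e <= e' ->
  pattern_base xi M e `<=` pattern_base xi M' e'.
Proof.
move=> MM ee zeta [/hausdorff_dist_ltP[e1 [e10 e1e C1]]].
move=> /hausdorff_dist_ltP[e2 [e20 e2e C2]] [g [bg gd lg]]; split.
- apply/hausdorff_dist_ltP; exists e1; split => //; first exact: lt_le_trans ee.
  exact: truncation_close C1.
- by apply/hausdorff_dist_ltP; exists e2; split => //; exact: lt_le_trans ee.
- by exists g; split => // v Vv; exact: lt_le_trans (gd _ Vv) ee.
Qed.

Lemma pattern_label_sur (xi : Pat) v : marks xi v -> exists i, label xi i = v.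
Proof. by have [_ _ s] := label_bij xi => /s[i _ <-]; exists i. Qed.

Lemma pattern_label_mem (xi : Pat) i : marks xi (label xi i).
Proof. by have [m _ _] := label_bij xi; exact: m. Qed.

Lemma pattern_base_open xi M e zeta : 0 < e -> pattern_base xi M e zeta ->
  exists2 e', 0 < e' & pattern_base zeta M e' `<=` pattern_base xi M e.
Proof.
move=> e0 [/hausdorff_dist_ltP[e1 [e10 e1e C1]]].
move=> /hausdorff_dist_ltP[e2 [e20 e2e C2]] [g [bg gd lg]].
pose e3 := \big[Num.max/0]_(i < N) enorm (label zeta i - label xi i).
have e3e : e3 < e.
  rewrite /e3; elim/big_ind: _ => // [x y xe ye|i _]; first by rewrite gt_max xe ye.
  by rewrite lg; apply: gd; exact: pattern_label_mem.
have e3i i : enorm (label zeta i - label xi i) <= e3 by exact: le_bigmax_cond.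
pose m := Num.min (e - e1) (Num.min (e - e2) (e - e3)).
have m0 : 0 < m by rewrite !lt_min !subr_gt0 e1e e2e e3e.
have me1 : m <= e - e1 by rewrite /m ge_min lexx.
have me2 : m <= e - e2 by rewrite /m !ge_min lexx orbT.
have me3 : m <= e - e3 by rewrite /m !ge_min lexx !orbT.
exists m => // eta [/hausdorff_dist_ltP[f1 [f10 f1e D1]]].
move=> /hausdorff_dist_ltP[f2 [f20 f2e D2]] [h [bh hd lh]]; split.
- apply/hausdorff_dist_ltP; exists (e1 + f1); split; first exact: addr_ge0.
    by lra.
  exact: close_within_trans C1 D1.
- apply/hausdorff_dist_ltP; exists (e2 + f2); split; first exact: addr_ge0.
    by lra.
  exact: close_within_trans C2 D2.
- exists (h \o g); split.
  + have [gf gi gs] := bg; have [hf hi hs] := bh; split.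
    * by move=> v /gf/hf.
    * move=> x y /set_mem xV /set_mem yV hxy; apply: gi; rewrite ?inE//.
      by apply: hi => //; rewrite inE; exact: gf.
    * by move=> w /hs[v /gs[u uV <-] <-]; exists u.
  + move=> v /pattern_label_sur[i <-] /=.
    have gi : g (label xi i) = label zeta i by rewrite lg.
    rewrite gi (le_lt_trans (enorm_triangle (label zeta i) _ _))//.
    have := hd _ (pattern_label_mem zeta i); have := e3i i; lra.
  + by rewrite lh lg.
Qed.

Lemma pattern_nbhs_filter (xi : Pat) : ProperFilter (nbhs xi).
Proof.
have r2 : 0 < r%:num / 2 / 2 < r%:num / 2.
  have r0 : 0 < r%:num / 2 by rewrite divr_gt0.
  by rewrite divr_gt0//= ltr_pdivrMr// ltr_pMr// ltr1n.
apply: filter_from_proper; last first.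
  by move=> [M e] [/= _ /andP[e0 _]]; exists xi; exact: pattern_base_refl.
apply: filter_from_filter; first by exists (1, r%:num / 2 / 2); split.
move=> [M1 e1] [M2 e2] [/= M10 /andP[e10 e1r]] [/= M20 /andP[e20 e2r]].
exists (Num.max M1 M2, Num.min e1 e2).
  by split=> /=; rewrite ?lt_max ?M10// lt_min e10 e20/= gt_min e1r.
by move=> zeta /= H; split; move: H; apply: pattern_base_mono;
  rewrite ?le_max ?ge_min ?lexx ?orbT.
Qed.

Lemma pattern_nbhs_singleton (xi : Pat) (A : set Pat) : nbhs xi A -> A xi.
Proof.
by move=> [[M e] [/= _ /andP[e0 _]]]; apply; exact: pattern_base_refl.
Qed.

Lemma pattern_nbhs_nbhs (xi : Pat) (A : set Pat) :
  nbhs xi A -> nbhs xi (nbhs^~ A).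
Proof.
move=> [[M e] [/= M0 /andP[e0 er]] sA]; exists (M, e) => /=; first by rewrite e0.
move=> zeta /(pattern_base_open e0)[e' e'0 sub].
exists (M, Num.min e e') => /=.
  by rewrite lt_min e0 e'0/= gt_min er.
move=> eta H; apply: sA; apply: sub; apply: pattern_base_mono H => //.
by rewrite ge_min lexx orbT.
Qed.

HB.instance Definition _ := Nbhs_isNbhsTopological.Build Pat
  pattern_nbhs_filter pattern_nbhs_singleton pattern_nbhs_nbhs.

Lemma marks_shift_sub (a : E) (xi : Pat) :
  shift_set a (marks xi) `<=` del_shift a (lattice xi).
Proof. by apply: image_subset; exact: marks_sub. Qed.

Lemma label_shift_bij (a : E) (xi : Pat) :
  set_bij [set: 'I_N] (shift_set a (marks xi)) (fun i => label xi i - a).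
Proof.
have [m inj sur] := label_bij xi; split.
- by move=> i _; exists (label xi i) => //; exact: m.
- by move=> i j ? ? /addIr; exact: inj.
- by move=> _ [v /sur[i _ <-] <-]; exists i.
Qed.

Definition pattern_shift (a : E) (xi : Pat) : Pat :=
  Pattern (@marks_shift_sub a xi) (label_shift_bij a xi).

End Patterns.

Section Groupoids.

(* A groupoid carried by a subset of a type [T], with unit space a subset of a
   type [U]; [g] and [h] are composable when [gsrc g = grng h], and the values
   of the operations outside [garrows] and [gunits] are irrelevant. When [T]
   and [U] are topological, arrows and units get the relative topologies. *)
Record groupoid_data (U T : Type) : Type := GroupoidData {
  gunits : set U;
  garrows : set T;
  grng : T -> U;
  gsrc : T -> U;
  gunit : U -> T;
  gmul : T -> T -> T;
  ginv : T -> T }.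

Definition gcomposable U T (G : groupoid_data U T) : set (T * T) :=
  [set p | [/\ garrows G p.1, garrows G p.2 & gsrc G p.1 = grng G p.2]].

Definition is_groupoid U T (G : groupoid_data U T) : Prop :=
  [/\ forall g, garrows G g -> gunits G (grng G g) /\ gunits G (gsrc G g),
      forall u, gunits G u ->
        [/\ garrows G (gunit G u), grng G (gunit G u) = u &
            gsrc G (gunit G u) = u],
      forall g h, gcomposable G (g, h) ->
        [/\ garrows G (gmul G g h), grng G (gmul G g h) = grng G g &
            gsrc G (gmul G g h) = gsrc G h],
      forall g h k, gcomposable G (g, h) -> gcomposable G (h, k) ->
        gmul G (gmul G g h) k = gmul G g (gmul G h k) &
      forall g, garrows G g ->
        [/\ gmul G (gunit G (grng G g)) g = g,
            gmul G g (gunit G (gsrc G g)) = g &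
            [/\ garrows G (ginv G g),
                grng G (ginv G g) = gsrc G g,
                gsrc G (ginv G g) = grng G g,
                gmul G g (ginv G g) = gunit G (grng G g) &
                gmul G (ginv G g) g = gunit G (gsrc G g)]]].

Definition is_topological_groupoid (U T : topologicalType)
    (G : groupoid_data U T) : Prop :=
  [/\ is_groupoid G,
      [/\ {within garrows G, continuous (grng G)},
          {within garrows G, continuous (gsrc G)} &
          {within gunits G, continuous (gunit G)}],
      {within gcomposable G, continuous (fun p => gmul G p.1 p.2)} &
      {within garrows G, continuous (ginv G)}].

Definition relative_homeomorphism (T T' : topologicalType) (A : set T)
    (B : set T') (f : T -> T') : Prop :=
  [/\ set_bij A B f, {within A, continuous f} &
      exists g : T' -> T,
        [/\ set_bij B A g, {in A, cancel f g} & {within B, continuous g}]].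

Definition relative_open_map (T T' : topologicalType) (A : set T)
    (B : set T') (f : T -> T') : Prop :=
  forall O, open O -> exists2 O', open O' & f @` (A `&` O) = B `&` O'.

Definition continuous_open_map (T T' : topologicalType) (A : set T)
    (B : set T') (f : T -> T') : Prop :=
  [/\ {homo f : x / A x >-> B x}, {within A, continuous f} &
      relative_open_map A B f].

Definition topological_groupoid_iso (U T U' T' : topologicalType)
    (G : groupoid_data U T) (H : groupoid_data U' T') (phi : T -> T') : Prop :=
  [/\ relative_homeomorphism (garrows G) (garrows H) phi,
      forall g h, garrows G g -> garrows G h ->
        (gcomposable G (g, h) <-> gcomposable H (phi g, phi h)),
      forall g h, gcomposable G (g, h) ->
        phi (gmul G g h) = gmul H (phi g) (phi h) &
      forall g, garrows G g -> phi (ginv G g) = ginv H (phi g)].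

Definition blowup (U T W : Type) (G : groupoid_data U T) (Z : set W)
    (f : W -> U) : groupoid_data W (W * T * W) :=
  {| gunits := Z;
     garrows := [set p | [/\ Z p.1.1, garrows G p.1.2, Z p.2,
                   f p.1.1 = grng G p.1.2 & gsrc G p.1.2 = f p.2]];
     grng := fun p => p.1.1;
     gsrc := fun p => p.2;
     gunit := fun z => (z, gunit G (f z), z);
     gmul := fun p q => (p.1.1, gmul G p.1.2 q.1.2, q.2);
     ginv := fun p => (p.2, ginv G p.1.2, p.1.1) |}.

End Groupoids.

Section DeloneGroupoids.
Context {R : realType} {d : nat} {r Rc : {posnum R}} {N : nat} (hN : (0 < N)%N).
Notation E := 'rV[R]_d.
Notation Del := (delone d r Rc).
Notation Pat := (pattern d r Rc N).

Definition base_mark (xi : Pat) : E := label xi (Ordinal hN).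

Definition pointed_transversal (L0 : Del) : set Pat :=
  [set xi | hull_transversal L0 (lattice xi) /\ base_mark xi = 0].

(* The product of (xi, zeta) and (eta, theta) with eta = zeta - x, where x is
   the base mark of zeta, is (xi, zeta') with theta = zeta' - x. *)
Definition pattern_groupoid (L0 : Del) : groupoid_data Pat (Pat * Pat) :=
  {| gunits := pointed_transversal L0;
     garrows := [set p | [/\ lattice p.1 = lattice p.2, hull L0 (lattice p.1) &
                             base_mark p.1 = 0]];
     grng := fun p => p.1;
     gsrc := fun p => pattern_shift (base_mark p.2) p.2;
     gunit := fun xi => (xi, xi);
     gmul := fun p q => (p.1, pattern_shift (- base_mark p.2) q.2);
     ginv := fun p => (pattern_shift (base_mark p.2) p.2,
                       pattern_shift (base_mark p.2) p.1) |}.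

Definition point_groupoid (L0 : Del) : groupoid_data Del (Del * E) :=
  {| gunits := hull_transversal L0;
     garrows := [set p | hull_transversal L0 p.1 /\ delone_set p.1 p.2];
     grng := fun p => p.1;
     gsrc := fun p => del_shift p.2 p.1;
     gunit := fun L => (L, 0);
     gmul := fun p q => (p.1, p.2 + q.2);
     ginv := fun p => (del_shift p.2 p.1, - p.2) |}.

Definition blowup_point_groupoid (L0 : Del) :
    groupoid_data Pat (Pat * (Del * E) * Pat) :=
  blowup (point_groupoid L0) (pointed_transversal L0) (@lattice R d r Rc N).

Definition blowup_arrows (L0 : Del) : set (Pat * (Del * E) * Pat) :=
  [set p | [/\ garrows (point_groupoid L0) p.1.2,
               lattice p.1.1 = p.1.2.1,
               lattice p.2 = del_shift p.1.2.2 p.1.2.1,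
               base_mark p.1.1 = 0 &
               base_mark p.2 = 0]].

Definition to_blowup (p : Pat * Pat) : Pat * (Del * E) * Pat :=
  (p.1, (lattice p.1, base_mark p.2), pattern_shift (base_mark p.2) p.2).

End DeloneGroupoids.

(* Main.v *)
Require Import Defs.
From HB Require Import structures.
From mathcomp Require Import all_boot all_order all_algebra.
From mathcomp Require Import all_classical all_reals all_analysis.
From mathcomp Require Import lra.

Set Implicit Arguments.
Unset Strict Implicit.
Unset Printing Implicit Defensive.

Import Order.TTheory GRing.Theory Num.Theory.
Import numFieldNormedType.Exports.

Local Open Scope classical_set_scope.
Local Open Scope ring_scope.

(** The two topologies of the statement, one defined by Hausdorff distances of
    truncations and one by neighborhood bases, hide the same elementary notion.
    Two point sets are [locally_close M e] when each point of one in the ball of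
    radius [M] has a point of the other within [e]; the spheres that truncations
    carry only serve to absorb points lost at the boundary of the ball, and can
    be dropped at the price of shrinking [M] by [e]. Hence [nbhs_deloneP]: the
    sets of all [L'] locally close to [L] form a neighborhood base at [L].
    Likewise [nbhs_patternP]: a neighborhood of a pattern consists of the
    patterns whose lattice is locally close to the given one and whose labels
    are pointwise close to the given ones.

    From this description the shifts [(a, L) |-> L - a] and
    [(a, xi) |-> xi - a] are jointly continuous, and so are the lattice and the
    labels of a pattern. Every groupoid operation, the comparison map and its
    inverse [(xi, (L, x), zeta) |-> (xi, zeta + x)] are built from these maps,
    so they are continuous on the whole ambient spaces, a fortiori on the
    subsets of arrows. The algebraic identities then reduce to shifts forming
    an action of R^d, once a pattern is known to be determined by its lattice
    and its labels.

    The one step with geometric content is that [lattice] is open on pointed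
    patterns ([lattice_lift], [lattice_continuous_open_map]). If [L'] is
    locally close to the lattice of [xi], choose a point of [L'] within [r] of
    each label of [xi]. Uniform separation makes the choice injective, so it is
    a pattern close to [xi], and when [L'] contains 0 it forces the point
    chosen near the label 0 to be 0 itself. *)

(** * The Euclidean norm and the topology of R^d *)

Section EuclideanTopology.
Context {R : realType} {d : nat}.
Notation E := 'rV[R]_d.

Lemma coord_le_enorm (x : E) i : `|x ord0 i| <= enorm x.
Proof.
rewrite -(@ler_pXn2r _ 2)// ?nnegrE ?enorm_ge0// sqr_enorm real_normK ?num_real//.
by rewrite (bigD1 i)//= lerDl sumr_ge0// => j _; exact: sqr_ge0.
Qed.

Lemma enorm_le_coord (x : E) (s : R) :
  0 <= s -> (forall i, `|x ord0 i| <= s) -> enorm x <= d.+1%:R * s.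
Proof.
move=> s0 xs; rewrite -(@ler_pXn2r _ 2)// ?nnegrE ?enorm_ge0 ?mulr_ge0//.
rewrite sqr_enorm (@le_trans _ _ (\sum_(i < d) s ^+ 2))//.
  apply: ler_sum => i _; rewrite -[leLHS]real_normK ?num_real//.
  by rewrite ler_pXn2r// nnegrE.
rewrite sumr_const card_ord -[leLHS]mulr_natl exprMn ler_wpM2r ?sqr_ge0//.
by rewrite -natrX ler_nat (leq_trans (leqnSn d))// -mulnn leq_pmulr.
Qed.

(** The topology of ['rV[R]_d] comes from the sup norm; the two bounds above make
    Euclidean balls a neighborhood base for it. *)
Lemma nbhs_enormP (x : E) (A : set E) : nbhs x A <->
  exists2 e : R, 0 < e & forall y, enorm (y - x) <= e -> A y.
Proof.
split=> [/nbhs_ballP[e /= e0 xA]|[e e0 xA]].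
  exists (e / 2); first by rewrite divr_gt0.
  move=> y yx; apply: xA; split => // i j.
  rewrite (ord1 i) /ball/= distrC.
  have := coord_le_enorm (y - x) j; rewrite !mxE; lra.
apply/nbhs_ballP; exists (e / d.+1%:R) => /=; first by rewrite divr_gt0.
move=> y [_ xy]; apply: xA.
have -> : e = d.+1%:R * (e / d.+1%:R) by rewrite mulrC divfK.
apply: enorm_le_coord => [|i]; first by rewrite divr_ge0// ltW.
by rewrite !mxE distrC ltW//; exact: xy.
Qed.

End EuclideanTopology.

(** * Local closeness of point sets *)

Section LocalCloseness.
Context {R : realType} {d : nat}.
Notation E := 'rV[R]_d.
Implicit Types (A B : set E) (a b : E) (M e : R).

Definition approximable M e A B :=
  forall x, A x -> enorm x <= M -> exists2 y, B y & enorm (x - y) <= e.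

Definition locally_close M e A B := approximable M e A B /\ approximable M e B A.

Lemma locally_close_mono M M' e e' A B : M' <= M -> e <= e' ->
  locally_close M e A B -> locally_close M' e' A B.
Proof.
move=> MM ee [AB BA]; split=> x Xx xM.
  by have [|y ? xy] := AB x Xx; [exact: le_trans MM|exists y => //; exact: le_trans ee].
by have [|y ? xy] := BA x Xx; [exact: le_trans MM|exists y => //; exact: le_trans ee].
Qed.

(** The radius grows by [enorm a] since a point of [A - a] in the ball of radius
    [M] comes from a point of [A] at norm at most [M + enorm a]. *)
Lemma approximable_shift M e a b A B : approximable (M + enorm a) e A B ->
  approximable M (e + enorm (a - b)) (shift_set a A) (shift_set b B).
Proof.
move=> AB x /shift_setP Ax xM.
have [|y By xy] := AB _ Ax; first by rewrite (le_trans (ler_enormD _ _))// lerD2r.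
exists (y - b); first by apply/shift_setP; rewrite subrK.
have -> : x - (y - b) = (x + a - y) - (a - b).
  by apply/rowP => i; rewrite !mxE; lra.
by rewrite (le_trans (ler_enormD _ _))// enormN lerD2r.
Qed.

Lemma locally_close_shift M e a b A B :
  locally_close (M + enorm a + enorm (b - a)) e A B ->
  locally_close M (e + enorm (b - a)) (shift_set a A) (shift_set b B).
Proof.
move=> [AB BA]; split.
  rewrite enormB; apply: approximable_shift => x Ax xM; apply: AB => //.
  by rewrite (le_trans xM)// lerDl enorm_ge0.
apply: approximable_shift => x Bx xM; apply: BA => //.
rewrite (le_trans xM)// -addrA lerD2l.
by rewrite -{1}(subrK a b) addrC (le_trans (ler_enormD _ _))// addrC.
Qed.

(** When the point near [x] falls outside the ball of radius [M], the segment
    from [x] to it crosses the sphere, which belongs to every truncation. *)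
Lemma approximable_truncation M e A B : 0 <= e -> approximable M e A B ->
  forall x, truncation A M x ->
    exists2 y, truncation B M y & enorm (x - y) <= e.
Proof.
move=> e0 AB x [[Ax xM]|xM]; last by exists x; [right|rewrite subrr enorm0].
have [y By xy] := AB x Ax xM; have [yM|My] := leP (enorm y) M.
  by exists y => //; left.
by have [s sM xs] := sphere_between xM My; exists s; [right|exact: le_trans xy].
Qed.

Lemma locally_close_truncation M e A B : 0 <= e -> locally_close M e A B ->
  close_within e (truncation A M) (truncation B M).
Proof. by move=> e0 [AB BA]; split; exact: approximable_truncation. Qed.

(** A point at norm at most [M - e] is farther than [e'] from the sphere of
    radius [M], so its partner in the truncation is a genuine point of the set. *)
Lemma truncation_locally_close M e e' A B : 0 <= e' -> e' < e ->
  close_within e' (truncation A M) (truncation B M) ->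
  locally_close (M - e) e A B.
Proof.
move=> e'0 ee [AB BA].
suff half X Y : (forall x, truncation X M x ->
    exists2 y, truncation Y M y & enorm (x - y) <= e') ->
    approximable (M - e) e X Y by split; exact: half.
move=> XY x Xx xM; have [|y [[Yy _]|/= yM] xy] := XY x.
- by left; split => //=; lra.
- by exists y => //; lra.
- have := ler_enormD (y - x) x; rewrite subrK yM enormB; lra.
Qed.

End LocalCloseness.

(** * Neighborhoods and shifts of Delone sets *)

Section DeloneTopology.
Context {R : realType} {d : nat} {r Rc : {posnum R}}.
Notation E := 'rV[R]_d.
Notation Del := (delone d r Rc).

(** Working description of the topology of Delone sets, in which shifts move
    the two parameters in a controlled way. *)
Lemma nbhs_deloneP (L : Del) (A : set Del) : nbhs L A <->
  exists M e : R, [/\ 0 < M, 0 < e &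
    forall L' : Del, locally_close M e L L' -> A L'].
Proof.
split=> [/nbhs_ballP[e /= e0 LA]|[M [e [M0 e0 LA]]]].
  exists e^-1, (e / 2); rewrite invr_gt0 divr_gt0//; split => // L' LL'.
  apply: LA; apply/del_dist_ltP; exists e^-1; split; first by rewrite invr_gt0.
    by rewrite invf_plt ?posrE ?addr_gt0 ?invr_gt0// ltrDr.
  exists (e / 2); rewrite invrK; split; [by lra..|].
  by apply: locally_close_truncation => //; lra.
(* The distance bound yields a truncation radius [rho] above [T]: it must exceed
   [M + e] to keep the ball of radius [M], and [e^-1] to make [rho^-1] below [e]. *)
pose T := M + e + e^-1; have T0 : 0 < T by rewrite !addr_gt0 ?invr_gt0.
apply/nbhs_ballP; exists (1 + T)^-1 => /=; first by rewrite invr_gt0 addr_gt0.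
move=> L' /del_dist_ltP[rho [rho0 rhoT [e' [e'0 e'rho LL']]]]; apply: LA.
have Trho : T < rho.
  have rho1 : 0 < 1 + rho by rewrite addr_gt0.
  have T1 : 0 < 1 + T by rewrite addr_gt0.
  by move: rhoT; rewrite (ltf_pV2 rho1 T1) ltrD2l.
have e'e : e' < e.
  rewrite (lt_trans e'rho)// invf_plt ?posrE// (lt_trans _ Trho)// /T.
  by rewrite ltrDr addr_gt0.
apply: locally_close_mono (lexx e) (truncation_locally_close e'0 e'e LL').
rewrite lerBrDr (le_trans _ (ltW Trho))// /T lerDl invr_ge0 ltW//.
Qed.

Lemma del_shift_continuous :
  continuous (fun p : E * Del => del_shift p.1 p.2).
Proof.
move=> [a L] A /= /nbhs_deloneP[M [e [M0 e0 LA]]].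
have e20 : 0 < e / 2 by rewrite divr_gt0.
exists ([set b | enorm (b - a) <= e / 2],
        [set L' : Del | locally_close (M + enorm a + e / 2) (e / 2) L L']).
  split => /=; first by apply/nbhs_enormP; exists (e / 2).
  apply/nbhs_deloneP; exists (M + enorm a + e / 2), (e / 2); split => //.
  by rewrite addr_gt0// ltr_wpDr// enorm_ge0.
move=> [b L'] [/= ba LL']; apply: LA => /=.
apply: (@locally_close_mono _ _ M _ (e / 2 + enorm (b - a))) => //.
  by rewrite [leRHS]splitr lerD2l.
apply: locally_close_shift; apply: locally_close_mono LL' => //.
by rewrite lerD2l.
Qed.

Lemma del_shift0 (L : Del) : del_shift 0 L = L.
Proof.
by apply: delone_eq; apply/seteqP; split => x; rewrite /= shift_setP addr0.
Qed.

Lemma del_shiftD (a b : E) (L : Del) :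
  del_shift b (del_shift a L) = del_shift (a + b) L.
Proof.
apply: delone_eq; apply/seteqP.
by split => x; rewrite /= !shift_setP -addrA (addrC b).
Qed.

(** The shift by [a] is continuous and maps the orbit of [L0] to itself, hence
    also its closure. *)
Lemma hull_shift (a : E) (L0 L : Del) : hull L0 L -> hull L0 (del_shift a L).
Proof.
move=> L0L B LB.
have : nbhs L (del_shift a @^-1` B).
  have := @del_shift_continuous (a, L) B LB.
  move=> [[U V] /= [Ua VL] UVB]; apply: filterS VL => L' VL'.
  by apply: (UVB (a, L')); split => //=; exact: nbhs_singleton.
move=> /L0L[_ [[b _ <-]] Bab]; exists (del_shift (b + a) L0).
by split; [exists (b + a)|rewrite -del_shiftD].
Qed.

Lemma hull_transversal_shift (a : E) (L0 L : Del) :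
  hull L0 L -> delone_set L a -> hull_transversal L0 (del_shift a L).
Proof.
by move=> L0L La; split; [exact: hull_shift|apply/shift_setP; rewrite add0r].
Qed.

End DeloneTopology.

(** * Neighborhoods and shifts of patterns *)

Section PatternTopology.
Context {R : realType} {d : nat} {r Rc : {posnum R}} {N : nat}.
Notation E := 'rV[R]_d.
Notation Del := (delone d r Rc).
Notation Pat := (pattern d r Rc N).

Lemma marksE (xi : Pat) : marks xi = range (label xi).
Proof.
apply/seteqP; split=> [v /pattern_label_sur[i <-]|_ [i _ <-]]; first by exists i.
exact: pattern_label_mem.
Qed.

(** The marks are the range of the labels, and the remaining fields are proofs. *)
Lemma pattern_eq (xi zeta : Pat) :
  lattice xi = lattice zeta -> label xi =1 label zeta -> xi = zeta.
Proof.
move=> ll /funext ee; have mm : marks xi = marks zeta by rewrite !marksE ee.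
case: xi zeta ll ee mm => [L V c VL cV] [L' V' c' VL' cV'] /= ll ee mm.
by subst; congr Pattern; exact: Prop_irrelevance.
Qed.

Lemma label_inj (xi : Pat) : injective (label xi).
Proof. by have [_ inj _] := label_bij xi; move=> i j; apply: inj; rewrite inE. Qed.

Lemma lattice_label (xi : Pat) i : delone_set (lattice xi) (label xi i).
Proof. by apply: marks_sub; exact: pattern_label_mem. Qed.

(** The bijection that a basic neighborhood asks for is forced to send the
    [i]-th label to the [i]-th label, so closeness of the marks is closeness of
    the labels. *)
Lemma pattern_base_labels (xi zeta : Pat) (M e e' : R) : 0 <= e -> e < e' ->
  locally_close M e (lattice xi) (lattice zeta) ->
  (forall i, enorm (label zeta i - label xi i) <= e) ->
  pattern_base xi M e' zeta.
Proof.
move=> e0 ee LL ll; split.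
- apply/hausdorff_dist_ltP; exists e; split => //.
  exact: locally_close_truncation.
- apply/hausdorff_dist_ltP; exists e; split => //; rewrite !marksE.
  split=> _ [i _ <-].
    by exists (label zeta i); [exists i|rewrite enormB].
  by exists (label xi i); [exists i|].
- pose g v := if [pick i | label xi i == v] is Some i then label zeta i else 0.
  have gE i : g (label xi i) = label zeta i.
    rewrite /g; case: pickP => [j /eqP/label_inj -> //|/(_ i)].
    by rewrite eqxx.
  exists g; split; last by apply/funext => i /=; rewrite gE.
    rewrite !marksE; split.
    + by move=> _ [i _ <-]; exists i.
    + move=> _ _ /set_mem[i _ <-] /set_mem[j _ <-].
      by rewrite !gE => /label_inj ->.
    + by move=> _ [i _ <-]; exists (label xi i); [exists i|].
  by rewrite marksE => _ [i _ <-]; rewrite gE (le_lt_trans (ll i)).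
Qed.

(** Basic neighborhoods are restricted to a tolerance below [r / 2]; since they
    shrink with the tolerance, the restriction does not affect the topology. *)
Lemma nbhs_patternP (xi : Pat) (A : set Pat) : nbhs xi A <->
  exists M e : R, [/\ 0 < M, 0 < e &
    forall zeta : Pat, locally_close M e (lattice xi) (lattice zeta) ->
      (forall i, enorm (label zeta i - label xi i) <= e) -> A zeta].
Proof.
split=> [[[M e] [/= M0 /andP[e0 _]] xiA]|[M [e [M0 e0 xiA]]]].
  exists M, (e / 2); rewrite divr_gt0//; split => // zeta LL ll; apply: xiA.
  by apply: pattern_base_labels LL ll; lra.
pose e1 := Num.min e (r%:num / 4).
have e10 : 0 < e1 by rewrite lt_min e0/= divr_gt0.
have e1r : e1 < r%:num / 2.
  by rewrite gt_min; apply/orP; right; have : 0 < r%:num by []; lra.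
exists (M + e1, e1) => /=; first by rewrite addr_gt0// e10.
move=> zeta [/hausdorff_dist_ltP[e' [e'0 e'e LL]] _ [g [_ gd lg]]]; apply: xiA.
  have := truncation_locally_close e'0 e'e LL; rewrite addrK.
  by apply: locally_close_mono; rewrite // /e1 ge_min lexx.
move=> i; rewrite lg/= ltW// (lt_le_trans (gd _ (pattern_label_mem xi i)))//.
by rewrite /e1 ge_min lexx.
Qed.

Lemma lattice_continuous : continuous (@lattice R d r Rc N).
Proof.
move=> xi A /nbhs_deloneP[M [e [M0 e0 LA]]]; apply/nbhs_patternP.
by exists M, e; split => // zeta LL _; exact: LA.
Qed.

Lemma label_continuous i : continuous (fun xi : Pat => label xi i).
Proof.
move=> xi A /nbhs_enormP[e e0 lA]; apply/nbhs_patternP.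
by exists 1, e; split => // zeta _ ll; exact: lA.
Qed.

Lemma pattern_shift_continuous :
  continuous (fun p : E * Pat => pattern_shift p.1 p.2).
Proof.
move=> [a xi] A /= /nbhs_patternP[M [e [M0 e0 xiA]]].
have e20 : 0 < e / 2 by rewrite divr_gt0.
have := @del_shift_continuous R d r Rc (a, lattice xi)
  [set L' | locally_close M e (del_shift a (lattice xi)) L'].
have /[swap]/[apply] : nbhs (del_shift a (lattice xi))
    [set L' : Del | locally_close M e (del_shift a (lattice xi)) L'].
  by apply/nbhs_deloneP; exists M, e.
(* [U] and [V] control the shifted lattice; each of the two differences in a
   shifted label gets half of the tolerance. *)
move=> [[U V] /= [Ua VL] UV].
exists (U `&` [set b | enorm (b - a) <= e / 2],
        (@lattice R d r Rc N @^-1` V) `&`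
        [set zeta | forall i, enorm (label zeta i - label xi i) <= e / 2]).
  split; apply: filterI => //; first by apply/nbhs_enormP; exists (e / 2).
    exact: lattice_continuous VL.
  by apply/nbhs_patternP; exists 1, (e / 2); split.
move=> [b zeta] [/= [Ub ba] [Vz ll]]; apply: xiA => /=; first exact: (UV (b, _)).
move=> i; have -> : label zeta i - b - (label xi i - a) =
    (label zeta i - label xi i) - (b - a) by apply/rowP => j; rewrite !mxE; lra.
by rewrite (le_trans (ler_enormD _ _))// enormN [leRHS]splitr lerD.
Qed.

Lemma pattern_shift0 (xi : Pat) : pattern_shift 0 xi = xi.
Proof. by apply: pattern_eq => [|i] /=; rewrite ?del_shift0 ?subr0. Qed.

Lemma pattern_shiftD (a b : E) (xi : Pat) :
  pattern_shift b (pattern_shift a xi) = pattern_shift (a + b) xi.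
Proof. by apply: pattern_eq => [|i] /=; rewrite ?del_shiftD// opprD addrA. Qed.

Lemma pattern_shiftK (a : E) (xi : Pat) :
  pattern_shift (- a) (pattern_shift a xi) = xi.
Proof. by rewrite pattern_shiftD subrr pattern_shift0. Qed.

Lemma pattern_shiftNK (a : E) (xi : Pat) :
  pattern_shift a (pattern_shift (- a) xi) = xi.
Proof. by rewrite pattern_shiftD addNr pattern_shift0. Qed.

(** If two labels had the same nearby point [y i] of [L'], both would lie in the
    closed ball of radius [r] about it, which holds at most one lattice point. *)
Lemma lattice_lift (xi : Pat) (L' : Del) (M e : R) : e <= r%:num ->
  (forall i, enorm (label xi i) <= M) -> approximable M e (lattice xi) L' ->
  exists2 zeta : Pat, lattice zeta = L' &
    forall i, enorm (label zeta i - label xi i) <= e.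
Proof.
move=> er xM LL'.
have /choice[y yP] i : exists y, delone_set L' y /\ enorm (y - label xi i) <= e.
  have [y L'y xy] := LL' _ (lattice_label xi i) (xM i).
  by exists y; rewrite enormB.
have y_inj : injective y.
  move=> i j yij; apply: (@label_inj xi).
  have [_ _ sep _] := deloneP (lattice xi).
  apply: (sep (y i)); try exact: lattice_label.
    by rewrite enormB (le_trans (yP i).2).
  by rewrite yij enormB (le_trans (yP j).2).
have yL' : range y `<=` L' by move=> _ [i _ <-]; exact: (yP i).1.
have yB : set_bij [set: 'I_N] (range y) y.
  by split=> [i _|i j _ _ /y_inj//|//]; exists i.
by exists (Pattern yL' yB) => //= i; exact: (yP i).2.
Qed.

(** Openness of [lattice] at [xi]; the extra bound [s] keeps track of how far the
    labels move, from which the base mark is identified later on. *)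
Lemma nbhs_lattice_lift (xi : Pat) (O : set Pat) (s : R) : 0 < s -> nbhs xi O ->
  nbhs (lattice xi) [set L' | exists zeta : Pat, [/\ O zeta, lattice zeta = L' &
    forall i, enorm (label zeta i - label xi i) <= s]].
Proof.
move=> s0 /nbhs_patternP[M [e [M0 e0 xiO]]].
pose e1 := Num.min e (Num.min s r%:num).
have e10 : 0 < e1 by rewrite !lt_min e0 s0/=.
have e1e : e1 <= e by rewrite ge_min lexx.
have e1s : e1 <= s by rewrite !ge_min lexx orbT.
have e1r : e1 <= r%:num by rewrite !ge_min lexx !orbT.
(* The sum is a crude bound for the norms of all labels. *)
pose M1 := M + \sum_i enorm (label xi i).
have sM : M <= M1 by rewrite lerDl sumr_ge0// => i _; exact: enorm_ge0.
have M1l i : enorm (label xi i) <= M1.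
  rewrite /M1 (bigD1 i)//= addrCA lerDl addr_ge0 ?(ltW M0)//.
  by rewrite sumr_ge0// => j _; exact: enorm_ge0.
apply/nbhs_deloneP; exists M1, e1; split=> // [|L' LL']; first exact: lt_le_trans sM.
have [zeta zL' zl] := lattice_lift e1r M1l LL'.1.
exists zeta; split => // [|i]; last exact: le_trans e1s.
apply: xiO => [|i]; last exact: le_trans e1e.
by rewrite zL'; exact: locally_close_mono LL'.
Qed.

End PatternTopology.

(** * Topological preliminaries *)

(** The open set required downstairs is the interior of the points that lie in
    the image or outside [B]. *)
Lemma relative_open_mapP (T T' : topologicalType) (A : set T) (B : set T')
    (f : T -> T') : {homo f : x / A x >-> B x} ->
  (forall x O, A x -> nbhs x O ->
     nbhs (f x) [set y | B y -> (f @` (A `&` O)) y]) ->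
  relative_open_map A B f.
Proof.
move=> AB fO O oO; pose S := [set y | B y -> (f @` (A `&` O)) y].
exists S°; first exact: open_interior.
apply/seteqP; split=> [_ [x [Ax Ox] <-]|y [By /interior_subset]]; last exact.
by split; [exact: AB|apply: fO => //; exact: open_nbhs_nbhs].
Qed.

Lemma continuous_pair (T U V : topologicalType) (f : T -> U) (g : T -> V) :
  continuous f -> continuous g -> continuous (fun x => (f x, g x)).
Proof. by move=> cf cg x; apply: cvg_pair; [exact: cf|exact: cg]. Qed.

Lemma continuous_fst (T U V : topologicalType) (f : T -> U * V) :
  continuous f -> continuous (fun x => (f x).1).
Proof. by move=> cf x; apply: (cvg_comp _ _ (cf x)); exact: cvg_fst. Qed.

Lemma continuous_snd (T U V : topologicalType) (f : T -> U * V) :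
  continuous f -> continuous (fun x => (f x).2).
Proof. by move=> cf x; apply: (cvg_comp _ _ (cf x)); exact: cvg_snd. Qed.

Section Composition.
Context {R : realType} {d : nat} {r Rc : {posnum R}} {N : nat}.
Context {T : topologicalType}.
Notation E := 'rV[R]_d.
Implicit Types (a b : T -> E).

Lemma continuous_del_shift a (L : T -> delone d r Rc) :
  continuous a -> continuous L -> continuous (fun x => del_shift (a x) (L x)).
Proof.
move=> ca cL x.
apply: (@continuous_comp _ _ _ (fun x => (a x, L x)) (fun p => del_shift p.1 p.2)).
  exact: continuous_pair.
exact: del_shift_continuous.
Qed.

Lemma continuous_pattern_shift a (xi : T -> pattern d r Rc N) :
  continuous a -> continuous xi ->
  continuous (fun x => pattern_shift (a x) (xi x)).
Proof.
move=> ca cxi x.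
apply: (@continuous_comp _ _ _ (fun x => (a x, xi x))
  (fun p => pattern_shift p.1 p.2)).
  exact: continuous_pair.
exact: pattern_shift_continuous.
Qed.

Lemma continuous_lattice (xi : T -> pattern d r Rc N) :
  continuous xi -> continuous (fun x => lattice (xi x)).
Proof.
by move=> cxi x; apply: continuous_comp; [exact: cxi|exact: lattice_continuous].
Qed.

Lemma continuous_base_mark (hN : (0 < N)%N) (xi : T -> pattern d r Rc N) :
  continuous xi -> continuous (fun x => base_mark hN (xi x)).
Proof.
move=> cxi x; apply: (@continuous_comp _ _ _ xi (base_mark hN)); first exact: cxi.
exact: label_continuous.
Qed.

Lemma continuous_opp a : continuous a -> continuous (fun x => - a x).
Proof. by move=> ca x; apply: cvgN; exact: ca. Qed.

Lemma continuous_add a b :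
  continuous a -> continuous b -> continuous (fun x => a x + b x).
Proof. by move=> ca cb x; apply: cvgD; [exact: ca|exact: cb]. Qed.

End Composition.

(** * The groupoids and their isomorphism *)

Section Isomorphism.
Context {R : realType} {d N : nat} {r Rc : {posnum R}} (hN : (0 < N)%N).
Context (L0 : delone d r Rc).
Notation E := 'rV[R]_d.
Notation Del := (delone d r Rc).
Notation Pat := (pattern d r Rc N).
Notation base := (base_mark hN).

(** Refolds the base mark after simplification has exposed the label. *)
Lemma base_markE (xi : Pat) : label xi (Ordinal hN) = base xi.
Proof. by []. Qed.

Lemma lattice_base_mark (xi : Pat) : delone_set (lattice xi) (base xi).
Proof. exact: lattice_label. Qed.

Lemma point_groupoid_topological : is_topological_groupoid (point_groupoid L0).
Proof.
split.
- split=> /=.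
  + by move=> [L x] [[LL0 ?] Lx]; split; [|exact: hull_transversal_shift].
  + by move=> L [LL0 Lz]; rewrite del_shift0.
  + move=> [L x] [L' y] [/= [LL0 Lx] [_ +] LL']; rewrite -{}LL' => /shift_setP Ly.
    by rewrite del_shiftD (addrC x).
  + by move=> [L x] [L' y] [L'' z] _ _ /=; rewrite addrA.
  + move=> [L x] [[/= LL0 Lz] /= Lx]; rewrite add0r addr0 del_shiftD !subrr del_shift0.
    rewrite addNr; do 2!split=> //; split; first exact: hull_transversal_shift.
    by rewrite shift_setP addNr.
- split; apply: continuous_subspaceT.
  + by apply: continuous_fst => x; exact: cvg_id.
  + apply: continuous_del_shift; [apply: continuous_snd|apply: continuous_fst];
      by move=> x; exact: cvg_id.
  + by apply: continuous_pair; [move=> x; exact: cvg_id|exact: cst_continuous].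
- apply: continuous_subspaceT; apply: continuous_pair.
    by do 2 apply: continuous_fst; move=> x; exact: cvg_id.
  apply: continuous_add; apply: continuous_snd.
    by apply: continuous_fst => x; exact: cvg_id.
  by apply: continuous_snd => x; exact: cvg_id.
- apply: continuous_subspaceT; apply: continuous_pair.
    apply: continuous_del_shift; [apply: continuous_snd|apply: continuous_fst];
      by move=> x; exact: cvg_id.
  by apply: continuous_opp; apply: continuous_snd => x; exact: cvg_id.
Qed.

Lemma pattern_groupoid_is_groupoid : is_groupoid (pattern_groupoid hN L0).
Proof.
split=> /=.
- move=> [xi zeta] [/= xz xL0 x0]; split.
    by split=> //; split=> //; rewrite -x0; exact: lattice_base_mark.
  split; last exact: subrr.
  by rewrite /= -xz; apply: hull_transversal_shift; rewrite // xz; exact: lattice_base_mark.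
- by move=> xi [[xL0 _] x0]; rewrite x0 pattern_shift0.
- move=> [xi zeta] [eta theta] [/= [/= xz xL0 x0] [/= et eL0 e0] ze].
  split=> //; last by rewrite base_markE opprK pattern_shiftD addrC addrK.
  split=> //=; rewrite -et -ze /= del_shiftD subrr del_shift0; exact: xz.
- move=> [xi zeta] [eta theta] [kappa iota] _ _ /=.
  by rewrite base_markE pattern_shiftD opprB addrC.
- move=> [xi zeta] [/= xz xL0 x0].
  rewrite !base_markE x0 subrr sub0r oppr0 opprK pattern_shift0 !pattern_shiftK.
  by do 3!split=> //; [rewrite xz|rewrite -xz; exact: hull_shift].
Qed.

Lemma pattern_groupoid_topological :
  is_topological_groupoid (pattern_groupoid hN L0).
Proof.
split; first exact: pattern_groupoid_is_groupoid.
- split; apply: continuous_subspaceT.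
  + by apply: continuous_fst => x; exact: cvg_id.
  + apply: continuous_pattern_shift; first apply: continuous_base_mark;
      by apply: continuous_snd => x; exact: cvg_id.
  + by apply: continuous_pair => x; exact: cvg_id.
- apply: continuous_subspaceT; apply: continuous_pair.
    by do 2 apply: continuous_fst; move=> x; exact: cvg_id.
  apply: continuous_pattern_shift.
    apply: continuous_opp; apply: continuous_base_mark; apply: continuous_snd.
    by apply: continuous_fst => x; exact: cvg_id.
  by do 2 apply: continuous_snd; move=> x; exact: cvg_id.
- apply: continuous_subspaceT; apply: continuous_pair;
    (apply: continuous_pattern_shift; first apply: continuous_base_mark);
    try by apply: continuous_snd => x; exact: cvg_id.
  by apply: continuous_fst => x; exact: cvg_id.
Qed.

(** A lift [zeta] of a nearby Delone set may be chosen with base mark within [r]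
    of 0; as 0 belongs to that Delone set, separation makes the base mark 0, so
    the lift stays in the pointed transversal. *)
Lemma lattice_continuous_open_map :
  continuous_open_map (pointed_transversal hN L0) (hull_transversal L0)
    (@lattice R d r Rc N).
Proof.
have lP : {homo @lattice R d r Rc N : xi / pointed_transversal hN L0 xi
    >-> hull_transversal L0 xi} by move=> xi [].
split=> //; first exact/continuous_subspaceT/lattice_continuous.
apply: relative_open_mapP => // xi O [_ x0] xiO.
apply: filterS (nbhs_lattice_lift (gt0 r) xiO) => _ [zeta [Oz <- zl]] Hz.
exists zeta => //; split=> //; split=> //.
have [_ _ sep _] := deloneP (lattice zeta).
apply: (sep 0) => //; first exact: lattice_base_mark.
- exact: Hz.2.
- by have := zl (Ordinal hN); rewrite -[label xi _]/(base xi) x0.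
- by rewrite subrr enorm0.
Qed.

(** The condition on the source lattice in the blow-up is automatic, because
    [L - x] contains 0 whenever [L] contains [x]. *)
Lemma garrows_blowup :
  garrows (blowup_point_groupoid hN L0) = blowup_arrows hN L0.
Proof.
apply/seteqP; split=> [[[xi [L x]] zeta]|[[xi [L x]] zeta]] /=.
  by move=> [[/= _ x0] [/= HL Lx] [/= _ z0] xL zL].
move=> [/= [/= HL Lx] xL zL x0 z0]; split=> //=; split; rewrite ?xL//= ?zL//.
exact: hull_transversal_shift HL.1 Lx.
Qed.

Lemma to_blowup_arrows (p : Pat * Pat) : garrows (pattern_groupoid hN L0) p ->
  garrows (blowup_point_groupoid hN L0) (to_blowup hN p).
Proof.
rewrite garrows_blowup; case: p => xi zeta [/= xz xL0 x0]; split=> //=.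
- split=> /=; last by rewrite xz; exact: lattice_base_mark.
  by split=> //; rewrite -x0; exact: lattice_base_mark.
- by rewrite xz.
- exact: subrr.
Qed.

(** The inverse of [to_blowup]: shifting by [- x] moves the base mark of the last
    pattern from 0 back to [x]. *)
Definition of_blowup (p : Pat * (Del * E) * Pat) : Pat * Pat :=
  (p.1.1, pattern_shift (- p.1.2.2) p.2).

Lemma of_blowup_arrows p : garrows (blowup_point_groupoid hN L0) p ->
  garrows (pattern_groupoid hN L0) (of_blowup p).
Proof.
rewrite garrows_blowup; case: p => [[xi [L x]] zeta] [/= [/= HL _] xL zL x0 z0].
split=> //=; last by rewrite xL; exact: HL.1.
by rewrite zL del_shiftD subrr del_shift0.
Qed.

Lemma to_blowupK : cancel (to_blowup hN) of_blowup.
Proof. by move=> [xi zeta]; rewrite /of_blowup/= pattern_shiftK. Qed.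

Lemma of_blowupK p : garrows (blowup_point_groupoid hN L0) p ->
  to_blowup hN (of_blowup p) = p.
Proof.
rewrite garrows_blowup; case: p => [[xi [L x]] zeta] [/= _ xL _ _ z0].
rewrite /to_blowup/of_blowup/= base_markE z0 opprK add0r xL.
by rewrite pattern_shiftNK.
Qed.

Lemma to_blowup_homeomorphism :
  relative_homeomorphism (garrows (pattern_groupoid hN L0))
    (garrows (blowup_point_groupoid hN L0)) (to_blowup hN).
Proof.
split.
- split=> [p|p q _ _|p Hp]; first exact: to_blowup_arrows.
    exact: (can_inj to_blowupK).
  by exists (of_blowup p); [exact: of_blowup_arrows|exact: of_blowupK].
- apply: continuous_subspaceT; have c1 : continuous (@fst Pat Pat).
    by apply: continuous_fst => x; exact: cvg_id.
  have c2 : continuous (@snd Pat Pat) by apply: continuous_snd => x; exact: cvg_id.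
  apply: continuous_pair; [apply: continuous_pair => //; apply: continuous_pair|].
  + exact: continuous_lattice.
  + exact: continuous_base_mark.
  + by apply: continuous_pattern_shift => //; exact: continuous_base_mark.
- exists of_blowup; split.
  + split=> [p|p q /set_mem Hp /set_mem Hq pq|p Hp]; first exact: of_blowup_arrows.
      by rewrite -(of_blowupK Hp) pq of_blowupK.
    by exists (to_blowup hN p); [exact: to_blowup_arrows|exact: to_blowupK].
  + by move=> p _; exact: to_blowupK.
  + apply: continuous_subspaceT; apply: continuous_pair.
      by do 2 apply: continuous_fst; move=> x; exact: cvg_id.
    apply: continuous_pattern_shift; last first.
      by apply: continuous_snd => x; exact: cvg_id.
    apply: continuous_opp; do 2 apply: continuous_snd.
    by apply: continuous_fst => x; exact: cvg_id.
Qed.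

(** Both composability conditions read: the second pattern, shifted to its base
    mark, is the first pattern of the next arrow. They are the same condition. *)
Lemma to_blowup_iso : topological_groupoid_iso (pattern_groupoid hN L0)
  (blowup_point_groupoid hN L0) (to_blowup hN).
Proof.
split; first exact: to_blowup_homeomorphism.
- move=> g h Hg Hh; split=> -[/= _ _ gh]; split=> //; exact: to_blowup_arrows.
- move=> [xi zeta] [eta theta] _ /=.
  by rewrite /to_blowup/= !base_markE pattern_shiftD opprK [_ + base zeta]addrC addKr.
- move=> [xi zeta] [/= xz _ x0].
  by rewrite /to_blowup/= base_markE x0 sub0r pattern_shiftK xz.
Qed.

End Isomorphism.

Theorem proposition6p50 (R : realType) (d N : nat) (r Rc : {posnum R})
    (hd : (0 < d)%N) (hN : (0 < N)%N) (hrR : r%:num < Rc%:num)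
    (L0 : delone d r Rc) :
  [/\ is_topological_groupoid (point_groupoid L0),
      is_topological_groupoid (pattern_groupoid hN L0),
      continuous_open_map (pointed_transversal hN L0) (hull_transversal L0)
        (@lattice R d r Rc N),
      garrows (blowup_point_groupoid hN L0) = blowup_arrows hN L0 &
      topological_groupoid_iso (pattern_groupoid hN L0)
        (blowup_point_groupoid hN L0) (to_blowup hN)].
Proof.
split.
- exact: point_groupoid_topological.
- exact: pattern_groupoid_topological.
- exact: lattice_continuous_open_map.
- exact: garrows_blowup.
- exact: to_blowup_iso.
Qed.
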